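(* Consider the multi-period electricity market clearing problem with storage orders, with periods $\mathcal T=\{1,\dots,T\}$: $$\max\ \sum_{t\in\mathcal T}\sum_{o\in\mathcal O_t^e}P_{o,t}^eQ_{o,t}^ex_{o,t}^e-\sum_{s\in\mathcal{TS}}\sum_{t\in\mathcal T}P_s^{spread}Q_{s,t}^{out}x_{s,t}^{out}$$ subject to $$\sum_{o\in\mathcal O_t^e}Q_{o,t}^ex_{o,t}^e=-\sum_{s}Q_{s,t}^{out}x_{s,t}^{out}-\sum_sQ_{s,t}^{in}x_{s,t}^{in}\eta_s^{in},\quad t\in\mathcal T\quad[\pi_t^e],$$ $$e_{s,t}=e_{s,t-1}+Q_{s,t}^{in}x_{s,t}^{in}+Q_{s,t}^{out}x_{s,t}^{out}\eta_s^{out},\qquad e_{s,t}\le E_s^{max},\qquad t\in\mathcal T,\ s\in\mathcal{TS},$$ $$e_{s,0}=e_{s,T}=E_s^i,\ s\in\mathcal{TS};\qquad e_{s,t}\ge0,\quad 0\le x_{o,t}^e\le1,\quad 0\le x_{s,t}^{in}\le1,\quad 0\le x_{s,t}^{out}\le1 .$$ Let $(\pi_t^e)_{t\in\mathcal T}$ be market prices obtained as optimal dual variables of the electricity balance constraints. Then any optimal solution of this problem is such that, for each storage order $s\in\mathcal{TS}$, the corresponding optimal values of $x_{s,t}^{in},x_{s,t}^{out}$ (with $e_{s,t}$), $t\in\mathcal T$, also solve the profit maximising problem of the individual market participant operating the storage order $s$ given the fixed market prices $\pi_t^e$: $$\max_{e_{s,t},x_{s,t}^{out},x_{s,t}^{in}}\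 \sum_{t\in\mathcal T}(-Q_{s,t}^{in})x_{s,t}^{in}\eta_s^{in}\pi_t^e-\sum_{t\in\mathcal T}Q_{s,t}^{out}x_{s,t}^{out}(\pi_t^e+P_s^{spread})$$ subject to, for $t\in\mathcal T$, $x_{s,t}^{in}\le1$, $x_{s,t}^{out}\le1$, $e_{s,t}=e_{s,t-1}+Q_{s,t}^{out}x_{s,t}^{out}\eta_s^{out}+Q_{s,t}^{in}x_{s,t}^{in}$, $e_{s,t}\le E_s^{max}$, $e_{s,0}=e_{s,T}=E_s^i$, and $e_{s,t},x_{s,t}^{in},x_{s,t}^{out}\ge0$.
   Context: $\mathcal O_t^e$ is a finite set of elementary electricity orders at period $t$; order $o$ has limit price $P_{o,t}^e\in\mathbb R$, quantity $Q_{o,t}^e\in\mathbb R$ ($<0$ for sell orders, $>0$ for buy orders) and acceptance ratio $x_{o,t}^e$. $\mathcal{TS}$ is a finite set of storage orders. For storage order $s$: $Q_{s,t}^{out}>0$ is the quantity that can be taken out of the market (bought) at $t$, $Q_{s,t}^{in}<0$ the quantity that can be injected (sold back) in the market at $t$, $x_{s,t}^{out},x_{s,t}^{in}$ the corresponding accepted fractions, $\eta_s^{out},\eta_s^{in}\in[0,1]$ the efficiencies of charging and discharging, $P_s^{spread}$ the cost or price spread to recover, $E_s^{max}$ the maximum storage level, $E_s^i$ the initial and final level, and $e_{s,t}$ the energy level at $t$. Sign convention for dual variables: $(\pi_t^e)$ are optimal dual variables of the balance constraints if they minimise over $\mathbb R^{\mathcal T}$ the dual function $\pi\mapsto\max\{\text{objective}-\sum_{t}\pi_t(\sum_{o}Q_{o,t}^ex_{o,t}^e+\sum_sQ_{s,t}^{out}x_{s,t}^{out}+\sum_sQ_{s,t}^{in}x_{s,t}^{in}\eta_s^{in})\}$,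 the maximum being over all variables satisfying all constraints other than the balance constraints (equivalently, $\pi$ is the corresponding component of an optimal solution of the linear programming dual). The involved feasible sets are assumed non-empty. *)

(* Defs.v *)
From mathcomp Require Import all_boot all_order all_algebra.
From mathcomp Require Import reals.

Set Implicit Arguments.
Unset Strict Implicit.
Unset Printing Implicit Defensive.

Import Order.TTheory GRing.Theory Num.Theory.

Local Open Scope ring_scope.

Definition maximizes (R : realType) (U : Type) (F : U -> Prop) (f : U -> R)
    (z : U) : Prop :=
  F z /\ forall z', F z' -> f z' <= f z.

(* The periods 1, ..., T are the elements of 'I_T, i : 'I_T standing for the  *)
(* period t = i + 1.  The set of orders may depend on the period.             *)
Record market (R : realType) (T : nat) := Market {
  order : 'I_T -> finType;
  price : forall t, order t -> R;
  quantity : forall t, order t -> R;     (* < 0 for sell, > 0 for buy orders *)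
  storage : finType;
  Qout : storage -> 'I_T -> R;
  Qin : storage -> 'I_T -> R;
  eta_out : storage -> R;
  eta_in : storage -> R;
  Pspread : storage -> R;
  Emax : storage -> R;
  Einit : storage -> R                   (* both initial and final level *)
}.

Arguments price {R T} m t o.
Arguments quantity {R T} m t o.

(* Energy levels are indexed by the instants 0, ..., T, hence by 'I_T.+1. *)
Record plan (R : realType) (T : nat) := Plan {
  xout : 'I_T -> R;
  xin : 'I_T -> R;
  level : 'I_T.+1 -> R
}.

Record allocation (R : realType) (T : nat) (m : market R T) := Allocation {
  accept : forall t : 'I_T, order m t -> R;
  splan : storage m -> plan R T
}.

Section Defs.
Variables (R : realType) (T : nat) (m : market R T).
Implicit Types (s : storage m) (p : plan R T) (z : allocation m).
Implicit Types (t : 'I_T) (pi : 'I_T -> R).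

(* e_t and e_(t-1) for the period t *)
Definition level_at p t : R := level p (lift ord0 t).
Definition level_before p t : R := level p (widen_ord (leqnSn T) t).

(* The constraints on the variables of the storage order s are the same in    *)
(* the clearing problem and in the profit maximising problem of s.            *)
Definition storage_feasible s p : Prop :=
  [/\ forall t, level_at p t =
        level_before p t + Qin s t * xin p t + Qout s t * xout p t * eta_out s,
      level p ord0 = Einit s /\ level p ord_max = Einit s,
      forall t, 0 <= level_at p t <= Emax s,
      forall t, 0 <= xin p t <= 1
    & forall t, 0 <= xout p t <= 1].

Definition storage_profit pi s p : R :=
  \sum_t (- Qin s t) * xin p t * eta_in s * pi t
  - \sum_t Qout s t * xout p t * (pi t + Pspread s).

Definition storage_optimal pi s p : Prop :=
  maximizes (storage_feasible s) (storage_profit pi s) p.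

Definition objective z : R :=
  \sum_t \sum_(o : order m t) price m t o * quantity m t o * accept z o
  - \sum_s \sum_t Pspread s * Qout s t * xout (splan z s) t.

Definition balanced z : Prop :=
  forall t, \sum_(o : order m t) quantity m t o * accept z o =
    - (\sum_s Qout s t * xout (splan z s) t)
    - \sum_s Qin s t * xin (splan z s) t * eta_in s.

Definition relaxed_feasible z : Prop :=
  (forall t (o : order m t), 0 <= accept z o <= 1) /\
  (forall s, storage_feasible s (splan z s)).

Definition market_feasible z : Prop := balanced z /\ relaxed_feasible z.

Definition market_optimal z : Prop := maximizes market_feasible objective z.

Definition lagrangian pi z : R :=
  objective z
  - \sum_t pi t * (\sum_(o : order m t) quantity m t o * accept z o
                   + \sum_s Qout s t * xout (splan z s) t
                   + \sum_s Qin s t * xin (splan z s) t * eta_in s).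

Definition dual_value pi (v : R) : Prop :=
  exists2 z, maximizes relaxed_feasible (lagrangian pi) z & lagrangian pi z = v.

(* The dual function is total when relaxed_feasible is non-empty: the         *)
(* maximum is attained for every pi, as all the variables are bounded.        *)
Definition optimal_dual pi : Prop :=
  exists2 v, dual_value pi v & forall pi' v', dual_value pi' v' -> v <= v'.

End Defs.

(* Main.v *)
(* The clearing problem is a linear programme, so strong duality holds without
   any qualification condition: Farkas' lemma applied to the homogenised
   constraints gives prices pi' for which z maximises the Lagrangian, i.e. the
   dual function at pi' is at most objective z.  Since pi minimises the dual
   function, its dual value, which is at least lagrangian pi z = objective z, is
   equal to it, so z maximises the Lagrangian at pi over the relaxed problem.
   That problem and the Lagrangian split into one term per storage order, so
   replacing the plan of a single order cannot increase its profit. *)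
Require Import Defs.
From mathcomp Require Import all_boot all_order all_algebra.
From mathcomp Require Import reals boolp ring lra.

Set Implicit Arguments.
Unset Strict Implicit.
Unset Printing Implicit Defensive.

Import Order.TTheory GRing.Theory Num.Theory.

Local Open Scope ring_scope.

(* Bartl's induction on the number of inequalities: if the last functional f a
   is needed, some x1 with f i x1 <= 0 for the other i has g x1 > 0, hence
   f a x1 > 0, and the others suffice after projecting onto the kernel of f a
   along x1. *)
Lemma farkas (R : realFieldType) (V : lmodType R) (I : eqType) (r : seq I)
    (f : I -> V -> R) (g : V -> R) :
    uniq r -> (forall i, scalar (f i)) -> scalar g ->
    (forall x, (forall i, i \in r -> f i x <= 0) -> g x <= 0) ->
  exists2 lam : I -> R, forall i, 0 <= lam i &
    forall x, g x = \sum_(i <- r) lam i * f i x.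
Proof.
elim: r f g => [|a r IHr] f g /=.
  move=> _ _ g_lin gle0; exists (fun=> 0) => // x; rewrite big_nil.
  (* Without inequalities, [g] is nonpositive at both [x] and [- x], so it vanishes. *)
  have gN : g (- x) = - g x.
    have := g_lin (- 1) x 0; have := g_lin (- 1) 0 0.
    by rewrite scaler0 !addr0 scaleN1r => h0 ->; lra.
  have := gle0 x (fun _ => ltac:(by [])).
  have := gle0 (- x) (fun _ => ltac:(by [])).
  by rewrite gN; lra.
move=> /andP[a_r uniq_r] f_lin g_lin g_le0.
have [r_le0|] := EM (forall x, (forall i, i \in r -> f i x <= 0) -> g x <= 0).
  have [lam lam_ge0 gE] := IHr f g uniq_r f_lin g_lin r_le0.
  exists (fun i => if i == a then 0 else lam i) => [i|x].
    by case: ifP.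
  rewrite big_cons eqxx mul0r add0r gE; apply: eq_big_seq => i i_r.
  by case: eqP => // ia; rewrite -ia i_r in a_r.
move=> /existsNP[x1 /not_implyP[fx1 /negP]]; rewrite -ltNge => gx1.
have fax1 : 0 < f a x1.
  rewrite ltNge; apply/negP => fax1; move: gx1; rewrite ltNge => /negP; apply.
  by apply: g_le0 => i; rewrite in_cons => /predU1P[->//|/fx1].
pose proj x := (- (f a x / f a x1)) *: x1 + x.
have f0 h : scalar h -> forall x, h (proj x) = h x - f a x / f a x1 * h x1.
  by move=> h_lin x; rewrite /proj h_lin; ring.
have projlin h : scalar h -> scalar (h \o proj).
  by move=> h_lin k u v /=; rewrite !f0// !h_lin f_lin; field; rewrite gt_eqF.
have [||||lam lam_ge0 gE] := IHr (fun i => f i \o proj) (g \o proj).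
- by [].
- by move=> i; apply: projlin.
- exact: projlin.
- move=> x fx /=; apply: g_le0 => i; rewrite in_cons => /predU1P[->|/fx//].
  by rewrite f0// divfK ?gt_eqF// subrr.
(* The multiplier of [f a] is forced by evaluating the combination at [x1]; it is nonnegative
   because [g x1 > 0] while the other [f i x1] are nonpositive. *)
pose c := (g x1 - \sum_(i <- r) lam i * f i x1) / f a x1.
exists (fun i => if i == a then c else lam i) => [i|x].
  case: ifP => // _; rewrite divr_ge0 ?(ltW fax1)// subr_ge0.
  apply: le_trans (ltW gx1); rewrite big_seq; apply: sumr_le0 => j j_r.
  by rewrite mulr_ge0_le0 ?fx1.
rewrite big_cons eqxx.
rewrite (eq_big_seq (fun i => lam i * f i x)); last first.
  by move=> i i_r; case: eqP => // ia; rewrite -ia i_r in a_r.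
have := gE x; rewrite /= f0//.
under eq_bigr do rewrite f0// mulrBr mulrCA.
rewrite sumrB -mulr_sumr /c => /eqP; rewrite subr_eq => /eqP ->.
by field; rewrite gt_eqF.
Qed.

(** * Affine functions, polyhedra and Lagrange multipliers *)

Section Affine.
Variables (R : realFieldType) (V : lmodType R).
Implicit Types (f g : V -> R) (P : V -> Prop).

Definition affine f : Prop := scalar (fun x => f x - f 0).

Lemma affineP f : affine f -> forall a u v,
  f (a *: u + v) = a * (f u - f 0) + f v.
Proof. by move=> f_aff a u v; have := f_aff a u v => /= h; lra. Qed.

Lemma affine_cst c : affine (fun=> c).
Proof. by move=> a u v; rewrite subrr mulr0 addr0. Qed.

Lemma affineD f g : affine f -> affine g -> affine (fun x => f x + g x).
Proof. by move=> f_aff g_aff a u v; rewrite !affineP//; ring. Qed.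

Lemma affineMr f c : affine f -> affine (fun x => f x * c).
Proof. by move=> f_aff a u v; rewrite affineP//; ring. Qed.

Lemma affineMl f c : affine f -> affine (fun x => c * f x).
Proof. by move=> f_aff a u v; rewrite affineP//; ring. Qed.

Lemma affineN f : affine f -> affine (fun x => - f x).
Proof. by move=> f_aff a u v; rewrite affineP//; ring. Qed.

Lemma affine_sum (I : finType) (f : I -> V -> R) :
  (forall i, affine (f i)) -> affine (fun x => \sum_i f i x).
Proof.
move=> f_aff a u v; under eq_bigr do rewrite affineP//.
by rewrite big_split -mulr_sumr sumrB /=; ring.
Qed.

(** The index type is existential so that it can grow: an intersection is indexed by a disjoint
    union. *)
Definition polyhedron P : Prop := exists (I : finType) (f : I -> V -> R),
  (forall i, affine (f i)) /\ (forall x, P x <-> forall i, f i x <= 0).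

Lemma polyhedron_le f g : affine f -> affine g ->
  polyhedron (fun x => f x <= g x).
Proof.
move=> f_aff g_aff; exists unit, (fun _ x => f x + - g x); split=> [_|x].
  by apply: affineD => //; apply: affineN.
by rewrite -subr_le0; split=> // /(_ tt).
Qed.

Lemma polyhedronI P Q : polyhedron P -> polyhedron Q ->
  polyhedron (fun x => P x /\ Q x).
Proof.
move=> [I [f [f_aff PE]]] [J [g [g_aff QE]]].
exists (I + J)%type, (fun k => match k with inl i => f i | inr j => g j end).
split=> [[]//|x]; rewrite PE QE; split=> [[fx gx] []//|fgx].
by split=> [i|j]; [apply: (fgx (inl i))|apply: (fgx (inr j))].
Qed.

Lemma eq_polyhedron P Q : (forall x, P x <-> Q x) -> polyhedron P ->
  polyhedron Q.
Proof.
move=> PQ [I [f [f_aff PE]]]; exists I, f; split=> // x.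
by rewrite -PQ.
Qed.

Lemma polyhedron_eq f g : affine f -> affine g ->
  polyhedron (fun x => f x = g x).
Proof.
move=> f_aff g_aff.
apply: (@eq_polyhedron (fun x => f x <= g x /\ g x <= f x)) => [x|].
  by split=> [[fg gf]|->//]; apply/eqP; rewrite eq_le fg.
by apply: polyhedronI; apply: polyhedron_le.
Qed.

Lemma polyhedron_itv f a b : affine f -> polyhedron (fun x => a <= f x <= b).
Proof.
move=> f_aff.
apply: (@eq_polyhedron (fun x => a <= f x /\ f x <= b)) => [x|].
  by split=> [[-> ->]|/andP].
by apply: polyhedronI; apply: polyhedron_le => //; apply: affine_cst.
Qed.

Lemma polyhedron_forall (I : finType) (P : I -> V -> Prop) :
  (forall i, polyhedron (P i)) -> polyhedron (fun x => forall i, P i x).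
Proof.
move=> P_poly; suff [J [f [f_aff PE]]] :
    polyhedron (fun x => forall i, i \in enum I -> P i x).
  by exists J, f; split=> // x; rewrite -PE; split=> Px i //;
    apply: Px; rewrite mem_enum.
elim: (enum I) => [|i r IHr].
  by exists void, (fun _ _ => 0); split=> [[]|x]; split=> // _ [].
apply: eq_polyhedron (polyhedronI (P_poly i) IHr) => x; split=> [[Pi Pr] j|Px].
  by rewrite in_cons => /predU1P[->|/Pr].
by split=> [|j jr]; apply: Px; rewrite in_cons ?eqxx ?jr ?orbT.
Qed.

(** Farkas' lemma handles only linear functionals, so the constraints are homogenised with an extra
    coordinate [t]. Only the equalities [h] are dualised; those defining [P] keep their sign and
    drop out of the bound. *)
Lemma lagrange_multipliers (J : finType) P (h : J -> V -> R) (c : V -> R) z :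
    polyhedron P -> (forall j, affine (h j)) -> affine c ->
    P z -> (forall j, h j z = 0) ->
    (forall x, P x -> (forall j, h j x = 0) -> c x <= c z) ->
  exists mu : J -> R, forall x, P x -> c x - \sum_j mu j * h j x <= c z.
Proof.
move=> [I [f [f_aff PE]]] h_aff c_aff Pz hz z_max.
(* The value at (x, t) is t * k (t^-1 *: x) for t > 0, and the slope of k in the
   direction x for t = 0. *)
pose hom (k : V -> R) (y : V * R^o) : R := k y.1 - k 0 + y.2 * k 0.
have hom_lin k : affine k -> scalar (hom k).
  move=> k_aff a u v; rewrite /hom /= affineP//.
  by rewrite -[a *: (u.2 : R^o)]/(a * u.2); ring.
have hom1 k x : hom k (x, 1) = k x by rewrite /hom /= mul1r subrK.
(* Each equality is encoded as two opposite inequalities; the last functional encodes [0 <= t]. *)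
pose F (i : I + J + J + 'I_1) : V * R^o -> R := match i with
  | inl (inl (inl i)) => hom (f i)
  | inl (inl (inr j)) => hom (h j)
  | inl (inr j) => hom (fun x => - h j x)
  | inr _ => fun y => - y.2
  end.
have F_lin i : scalar (F i).
  move: i => [[[i|j]|j]|i] /=; try exact: hom_lin.
    by apply: hom_lin; apply: affineN.
  by move=> a u v /=; rewrite -[a *: (u.2 : R^o)]/(a * u.2); ring.
pose g := hom (fun x => c x + - c z).
have g_lin : scalar g.
  by apply: hom_lin; apply: affineD => //; apply: affine_cst.
have [|lam lam_ge0 gE] :=
    farkas (enum_uniq {: I + J + J + 'I_1}) F_lin g_lin.
  move=> [x t] Fx.
  have fx i : hom (f i) (x, t) <= 0.
    by apply: (Fx (inl (inl (inl i)))); rewrite mem_enum.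
  have hx j : hom (h j) (x, t) = 0.
    have := Fx (inl (inl (inr j))); have := Fx (inl (inr j)).
    by rewrite !mem_enum /= /hom /= => /(_ isT) ? /(_ isT) ?; lra.
  have : 0 <= t.
    by rewrite -oppr_le0; apply: (Fx (inr ord0)); rewrite mem_enum.
  rewrite le_eqVlt => /predU1P[t0|t_gt0].
    (* For [t = 0], [x] is a recession direction: [x + z] is again feasible, so [c] cannot increase
       along [x]. *)
    have shift k : affine k -> k (x + z) = hom k (x, t) + k z.
      by move=> k_aff; rewrite -[x]scale1r affineP// /hom /= -t0 scale1r; ring.
    have /= : c (x + z) <= c z.
      apply: z_max => [|j]; last by rewrite shift// hx hz addr0.
      apply/PE => i; rewrite shift//.
      by rewrite -[leRHS]addr0 lerD//; apply: (PE z).1.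
    by rewrite shift// /g /hom /= -t0 => ?; lra.
  (* For [t > 0], the point [t^-1 *: x] satisfies the original constraints, and optimality of [z]
     applies to it. *)
  have scale k : affine k -> hom k (x, t) = t * k (t^-1 *: x).
    move=> k_aff; rewrite -[_ *: x]addr0 affineP// /hom /=.
    by field; rewrite gt_eqF.
  rewrite /g scale; last by apply: affineD => //; apply: affine_cst.
  rewrite pmulr_rle0// subr_le0; apply: z_max => [|j].
    by apply/PE => i; have := fx i; rewrite scale// pmulr_rle0.
  have /eqP := hx j; rewrite scale// mulf_eq0 gt_eqF//= => /eqP; exact.
(* The free-sign multiplier of an equality is the difference of the multipliers of its two
   inequalities; the Farkas identity is read at [t = 1]. *)
exists (fun j => lam (inl (inl (inr j))) - lam (inl (inr j))) => x Px.
have := gE (x, 1); rewrite /g hom1 big_enum /= !big_sumType /= big_ord1 /=.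
have -> : \sum_j lam (inl (inr j)) * hom (fun y => - h j y) (x, 1) =
    - \sum_j lam (inl (inr j)) * h j x.
  by rewrite -sumrN; apply: eq_bigr => j _; rewrite hom1 mulrN.
rewrite (eq_bigr _ (fun i _ => congr1 _ (hom1 (f i) x))).
rewrite (eq_bigr _ (fun j _ => congr1 _ (hom1 (h j) x))).
have : \sum_i lam (inl (inl (inl i))) * f i x <= 0.
  by apply: sumr_le0 => i _; rewrite mulr_ge0_le0//; apply: (PE x).1.
have := lam_ge0 (inr ord0).
under [X in _ -> _ -> _ -> _ - X <= _]eq_bigr do rewrite mulrBl.
by rewrite sumrB; lra.
Qed.

End Affine.

(** * The clearing problem as a linear programme, and its duality *)

Section Coordinates.
Variables (R : realType) (T : nat) (m : market R T).

(** Allocations are records without a module structure; listing all their scalar variables makes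
    them vectors, to which the results on polyhedra apply. *)
Definition coordinate : finType :=
  ({t : 'I_T & Defs.order m t} + storage m * ('I_T + 'I_T + 'I_T.+1))%type.

Definition allocation_of (x : {ffun coordinate -> R^o}) : allocation m :=
  Allocation (fun t o => x (inl (Tagged (Defs.order m) o)))
    (fun s => Plan (fun t => x (inr (s, inl (inl t))))
                   (fun t => x (inr (s, inl (inr t))))
                   (fun t => x (inr (s, inr t)))).

Lemma allocation_of_surj (z : allocation m) : exists x, allocation_of x = z.
Proof.
exists [ffun k => match k with
  | inl o => accept z (tagged o)
  | inr (s, inl (inl t)) => xout (splan z s) t
  | inr (s, inl (inr t)) => xin (splan z s) t
  | inr (s, inr t) => level (splan z s) t
  end].
case: z => acc pl; rewrite /allocation_of; congr Allocation.
  apply: functional_extensionality_dep => t; apply: funext => o.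
  by rewrite ffunE.
apply: funext => s; case pls : (pl s) => [xo xi e].
by congr Plan; apply: funext => t; rewrite ffunE /= pls.
Qed.

Lemma affine_coord (k : coordinate) :
  affine (fun x : {ffun coordinate -> R^o} => x k : R).
Proof. by move=> a u v; rewrite !ffunE subr0 subr0 subr0. Qed.

Lemma affine_objective : affine (fun x => objective (allocation_of x)).
Proof.
apply: affineD; last apply: affineN;
  by do 2!apply: affine_sum => ?; apply/affineMl/affine_coord.
Qed.

(** The bracket that [lagrangian] multiplies by [pi t]. *)
Definition excess_demand (z : allocation m) (t : 'I_T) : R :=
  \sum_(o : Defs.order m t) quantity m t o * accept z o
  + \sum_s Qout s t * xout (splan z s) t
  + \sum_s Qin s t * xin (splan z s) t * eta_in s.

Lemma affine_excess_demand t :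
  affine (fun x => excess_demand (allocation_of x) t).
Proof.
do 2?apply: affineD; apply: affine_sum => ?.
- exact/affineMl/affine_coord.
- exact/affineMl/affine_coord.
- exact/affineMr/affineMl/affine_coord.
Qed.

Lemma balancedP (z : allocation m) :
  balanced z <-> forall t, excess_demand z t = 0.
Proof.
by split=> bal t; have := bal t; rewrite /excess_demand => ?; lra.
Qed.

Lemma polyhedron_relaxed_feasible :
  polyhedron (fun x => relaxed_feasible (allocation_of x)).
Proof.
apply: polyhedronI.
  by do 2!apply: polyhedron_forall => ?; apply/polyhedron_itv/affine_coord.
apply: polyhedron_forall => s.
pose p x := splan (allocation_of x) s.
(* Nested binary conjunctions replace the five-fold one, to match [polyhedronI]. *)
apply: (@eq_polyhedron _ _ (fun x =>
    (forall t, level_at (p x) t = level_before (p x) t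
       + Qin s t * xin (p x) t + Qout s t * xout (p x) t * eta_out s) /\
    (level (p x) ord0 = Einit s /\ level (p x) ord_max = Einit s) /\
    (forall t, 0 <= level_at (p x) t <= Emax s) /\
    (forall t, 0 <= xin (p x) t <= 1) /\
    (forall t, 0 <= xout (p x) t <= 1))) => [x|].
  by split=> [[? [? [? [? ?]]]]|[]].
apply: polyhedronI.
  apply: polyhedron_forall => t; apply: polyhedron_eq.
    exact: affine_coord.
  do 2?apply: affineD; first exact: affine_coord.
  - exact/affineMl/affine_coord.
  - exact/affineMr/affineMl/affine_coord.
apply: polyhedronI.
  by apply: polyhedronI; apply: polyhedron_eq;
    [exact: affine_coord|exact: affine_cst|exact: affine_coord
    |exact: affine_cst].
by do 2?apply: polyhedronI; apply: polyhedron_forall => t;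
  apply/polyhedron_itv/affine_coord.
Qed.

Lemma lagrangian_balanced pi (z : allocation m) :
  balanced z -> lagrangian pi z = objective z.
Proof.
move=> /balancedP z_bal; rewrite /lagrangian big1 ?subr0// => t _.
by rewrite -/(excess_demand z t) z_bal mulr0.
Qed.

(** The prices are the multipliers of the balance equalities over the polyhedron of all other
    constraints. *)
Lemma strong_duality (z : allocation m) : market_optimal z ->
  exists pi, dual_value m pi (objective z).
Proof.
move=> [[z_bal z_rel] z_max]; have [x xz] := allocation_of_surj z.
have [||x' Px' bal|pi pi_le] := @lagrange_multipliers _ _ _ _
    (fun t x => excess_demand (allocation_of x) t) _ x
    polyhedron_relaxed_feasible affine_excess_demand affine_objective.
- by rewrite xz.
- by rewrite xz; apply/balancedP.
- by rewrite /= xz; apply: z_max; split=> //; apply/balancedP.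
exists pi, z; last exact: lagrangian_balanced.
split=> // z'; have [x' <-] := allocation_of_surj z' => x'_rel.
by rewrite (lagrangian_balanced _ z_bal) -xz; apply: pi_le.
Qed.

Lemma optimal_dual_maximizes pi (z : allocation m) :
    optimal_dual m pi -> market_optimal z ->
  maximizes (@relaxed_feasible _ _ m) (lagrangian pi) z.
Proof.
move=> [v [z0 [z0_rel z0_max] <-] v_min] z_opt.
have [[z_bal z_rel] _] := z_opt.
have [pi' /v_min dual_le] := strong_duality z_opt.
(* The chain is [lagrangian pi z' <= lagrangian pi z0 <= objective z = lagrangian pi z]. *)
split=> // z' /z0_max /le_trans; apply.
by rewrite (lagrangian_balanced _ z_bal).
Qed.

(* Up to a term independent of the storage plans, the Lagrangian is the sum of
   the profits of the storage orders. *)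
Lemma lagrangian_storage_profit pi (z z' : allocation m) :
    accept z = accept z' ->
  lagrangian pi z - \sum_s storage_profit pi s (splan z s) =
  lagrangian pi z' - \sum_s storage_profit pi s (splan z' s).
Proof.
(* What remains is the surplus of the elementary orders at prices [pi], which sees [y] only through
   [accept y]. *)
suff E y : lagrangian pi y - \sum_s storage_profit pi s (splan y s) =
    \sum_t \sum_(o : Defs.order m t)
      (price m t o * quantity m t o - pi t * quantity m t o) * accept y o.
  by rewrite !E => ->.
have -> : \sum_s storage_profit pi s (splan y s) =
    - (\sum_s \sum_t Pspread s * Qout s t * xout (splan y s) t)
    - \sum_t pi t * (\sum_s Qout s t * xout (splan y s) t
                     + \sum_s Qin s t * xin (splan y s) t * eta_in s).
  under [X in _ = _ - X]eq_bigr do rewrite -big_split mulr_sumr.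
  rewrite [X in _ = _ - X]exchange_big -!sumrN -big_split.
  apply: eq_bigr => s _; rewrite /storage_profit -!sumrN -!big_split.
  by apply: eq_bigr => t _ /=; ring.
rewrite /lagrangian /objective.
under [X in _ - X - _ = _]eq_bigr do rewrite -addrA mulrDr.
rewrite big_split /= opprD.
have -> : \sum_t \sum_(o : Defs.order m t)
      (price m t o * quantity m t o - pi t * quantity m t o) * accept y o =
    \sum_t \sum_(o : Defs.order m t) price m t o * quantity m t o * accept y o
    - \sum_t pi t * \sum_(o : Defs.order m t) quantity m t o * accept y o.
  rewrite -sumrB; apply: eq_bigr => t _; rewrite mulr_sumr -sumrB.
  by apply: eq_bigr => o _; ring.
ring.
Qed.

End Coordinates.

Theorem proposition2 (R : realType) (T : nat) (m : market R T)
  (Qout_gt0 : forall (s : storage m) (t : 'I_T), 0 < Qout s t)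
  (Qin_lt0 : forall (s : storage m) (t : 'I_T), Qin s t < 0)
  (eta_out01 : forall s : storage m, 0 <= eta_out s <= 1)
  (eta_in01 : forall s : storage m, 0 <= eta_in s <= 1)
  (feasible_ex : exists z : allocation m, market_feasible z)
  (pi : 'I_T -> R) (pi_dual : optimal_dual m pi)
  (z : allocation m) (z_opt : market_optimal z) :
  forall s : storage m, storage_optimal pi s (splan z s).
Proof.
have [[z_acc z_sto] z_max] := optimal_dual_maximizes pi_dual z_opt.
move=> s; split=> // p p_feas.
pose z' := @Allocation _ _ m (@accept _ _ _ z)
  (fun s' => if s' == s then p else splan z s').
have z'_rel : relaxed_feasible z'.
  by split=> [//|s'] /=; case: eqP => [->|].
(* [z] and [z'] differ only in the plan of [s], so the profits of the other storage orders cancel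
   and the change of the Lagrangian is the change of profit of [s]. *)
have := @lagrangian_storage_profit _ _ _ pi z' z erefl.
rewrite (bigD1 s)//= eqxx (bigD1 s (F := fun s => _ pi s (splan z s)))//=.
rewrite (eq_bigr (fun s' => storage_profit pi s' (splan z s'))); last first.
  by move=> s' /negPf->.
by have := z_max _ z'_rel; lra.
Qed.
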